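(* Let $2<p<\infty$ and let $p'$ be given by $\frac1p+\frac1{p'}=1$. Let $\sigma$ be a measurable function on $\mathfrak X\times\Omega\times[0,\tau]$ such that $$\left(\int_\Omega\int_0^\tau q^{(\frac12-is)h_\omega(x)}\,q^{(\frac12+is)h_\omega(y)}\,\sigma(x,\omega,s)\,d\nu(\omega)\,d\mu(s)\right)_{(x,y)\in\mathfrak X\times\mathfrak X}\in L^{p'}(\mathfrak X\times\mathfrak X).$$ Then the corresponding pseudo-differential operator $T_\sigma:L^p(\mathfrak X)\to L^p(\mathfrak X)$ is a bounded operator.
   Context: Let $q\ge 2$ be an integer and let $\mathfrak X$ be (the vertex set of) the homogeneous tree of degree $q+1$: the connected graph without loops (cycles) in which every vertex has exactly $q+1$ neighbours. $d(x,y)$ is the number of edges of the geodesic from $x$ to $y$; a reference vertex $o$ is fixed and $|x|=d(o,x)$. $\mathfrak X$ and $\mathfrak X\times\mathfrak X$ carry counting measure. $\Omega$ is the set of infinite geodesic rays $\omega=(\omega_0,\omega_1,\dots)$ with $\omega_0=o$. The height function is $h_\omega(x)=\lim_{m\to\infty}(m-d(x,\omega_m))=2|c(x,\omega)|-|x|$, where $c(x,\omega)$ is the last vertex on the geodesic path $[o,x]$ that lies on $\omega$. $\nu$ is the probability measure on $\Omega$ (with the $\sigma$-algebra generated by the sets $E(x)=\{\omega:\omega\text{ passes through }x\}$) with $\nu(E(x))=\frac{q}{(q+1)q^{|x|}}$ for $x\neq o$. Put $\tau=\pi/\log q$ and $d\mu(s)=c_P|c(s)|^{-2}ds$ on $[0,\tau]$,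 with $c_P=\frac{q\log q}{2\pi(q+1)}$ and $c(z)=\frac{q^{1/2}}{q+1}\,\frac{q^{1/2+iz}-q^{-1/2-iz}}{q^{iz}-q^{-iz}}$. For finitely supported $f:\mathfrak X\to\mathbb C$ the Fourier-Helgason transform is $\mathcal Hf(\omega,s)=\sum_{y\in\mathfrak X}f(y)q^{(\frac12+is)h_\omega(y)}$. For measurable $\sigma$ and finitely supported $f$, the pseudo-differential operator with symbol $\sigma$ is $T_\sigma f(x)=\int_\Omega\int_0^\tau q^{(\frac12-is)h_\omega(x)}\sigma(x,\omega,s)\mathcal Hf(\omega,s)\,d\nu(\omega)d\mu(s)$; the integrals in the hypothesis are assumed to converge absolutely. Saying that $T_\sigma$ is bounded on $L^p(\mathfrak X)$ means that it extends from finitely supported functions to a bounded operator on $L^p(\mathfrak X)$. *)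

(* Defs.v *)
From HB Require Import structures.
From mathcomp Require Import all_boot all_order all_algebra.
From mathcomp Require Import complex.
From mathcomp Require Import all_classical all_reals all_analysis.
From mathcomp Require Import measurable_realfun.

Set Implicit Arguments.
Unset Strict Implicit.
Unset Printing Implicit Defensive.

Import Order.TTheory GRing.Theory Num.Theory.
Import numFieldNormedType.Exports.

Local Open Scope classical_set_scope.
Local Open Scope ring_scope.

(** * Homogeneous trees *)

Record homogeneous_tree (q : nat) := HomogeneousTree {
  tree_carrier : choiceType;
  adj : rel tree_carrier;
  root : tree_carrier;
  q_ge2 : (2 <= q)%N;
  adj_sym : symmetric adj;
  adj_irr : irreflexive adj;
  adj_connected : forall x y, exists s, path adj x s /\ last x s = y;
  (* a closed walk with at most 2 distinct vertices is an edge, not a cycle *)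
  adj_acyclic : forall s, (2 < size s)%N -> ~~ (cycle adj s && uniq s);
  adj_degree : forall x, ([set y | adj x y] #= `I_q.+1)%card
}.

(* A constant of its own, so that it can carry canonical structures. *)
Definition vertex (q : nat) (X : homogeneous_tree q) : Type := tree_carrier X.
Coercion vertex : homogeneous_tree >-> Sortclass.

Section tree.
Context (q : nat) (X : homogeneous_tree q).
Local Notation e := (@adj q X : rel (vertex X)).
Local Notation o := (root X : vertex X).

HB.instance Definition _ := Choice.copy (vertex X) (tree_carrier X).
HB.instance Definition _ := isPointed.Build (vertex X) o.

HB.instance Definition _ := @isMeasurable.Build default_measure_display
  (vertex X) discrete_measurable discrete_measurable0
  discrete_measurableC discrete_measurableU.

Definition walk (x y : X) (n : nat) : bool :=
  `[< exists s, [/\ path e x s, last x s = y & size s = n] >].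

Lemma walk_ex x y : exists n, walk x y n.
Proof.
have [s [ps ls]] := adj_connected x y.
by exists (size s); apply/asboolP; exists s.
Qed.

(* The geodesic joining two vertices of a tree is their shortest walk. *)
Definition dist (x y : X) : nat := ex_minn (walk_ex x y).

Definition vnorm (x : X) : nat := dist o x.

Definition is_ray (w : nat -> X) : Prop :=
  w 0%N = o /\ forall m n, (m <= n)%N -> dist (w m) (w n) = (n - m)%N.

Lemma dist_le x y s : path e x s -> last x s = y -> (dist x y <= size s)%N.
Proof.
move=> ps ls; rewrite /dist; case: ex_minnP => m _; apply.
by apply/asboolP; exists s.
Qed.

Lemma dist_path x y : exists s, [/\ path e x s, last x s = y & size s = dist x y].
Proof. by rewrite /dist; case: ex_minnP => m /asboolP. Qed.

Lemma distxx x : dist x x = 0%N.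
Proof. by apply/eqP; rewrite -leqn0; apply: (@dist_le _ _ [::]). Qed.

Lemma dist_triangle x y z : (dist x z <= dist x y + dist y z)%N.
Proof.
have [s [ps ls <-]] := dist_path x y; have [t [pt lt <-]] := dist_path y z.
by rewrite -size_cat; apply: dist_le; rewrite ?cat_path ?last_cat ?ps ls.
Qed.

(* A vertex has at most one neighbour that is not farther from the root. *)
Lemma closer_neighbour_uniq v y1 y2 : e v y1 -> e v y2 ->
  (vnorm y1 <= vnorm v)%N -> (vnorm y2 <= vnorm v)%N -> y1 = y2.
Proof.
move=> ey1 ey2 d1 d2; apply/eqP/negPn/negP => y12.
have avoid y : e v y -> (vnorm y <= vnorm v)%N ->
    exists s, [/\ path e o s, last o s = y & v \notin o :: s].
  move=> evy dy; have [s [ps ls ss]] := dist_path o y.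
  exists s; split => //; apply/negP => vs.
  case/splitPl: vs ps ls ss => s1 s2 ls1; rewrite cat_path last_cat ls1.
  move=> /andP[ps1 ps2] ls2; rewrite size_cat => ss.
  have := dist_le ps1 ls1; rewrite -/(vnorm v) => h.
  case: s2 ps2 ls2 ss => [|z s2] /= _ ls2 ss.
    by move: evy; rewrite -ls2 adj_irr.
  move: dy; rewrite /vnorm -ss => h'.
  by have := leq_trans h' h; rewrite addnS ltnNge leq_addr.
have [s1 [ps1 ls1 vs1]] := avoid _ ey1 d1.
have [s2 [ps2 ls2 vs2]] := avoid _ ey2 d2.
pose s := rev (belast o s1) ++ s2.
have ps : path e y1 s.
  rewrite cat_path -{1}ls1 rev_path.
  under eq_path do rewrite adj_sym.
  rewrite ps1 /=; suff -> : last y1 (rev (belast o s1)) = o by [].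
  by case: (s1) ls1 => [//|a l] _ /=; rewrite rev_cons last_rcons.
have ls : last y1 s = y2.
  rewrite last_cat; suff -> : last y1 (rev (belast o s1)) = o by [].
  by case: (s1) ls1 => [//|a l] _ /=; rewrite rev_cons last_rcons.
have vs : v \notin s.
  rewrite mem_cat mem_rev negb_or; apply/andP; split.
    by apply: contra vs1 => /mem_belast.
  by apply: contra vs2; rewrite inE => ->; rewrite orbT.
have vy1 : v != y1 by apply: contraTneq ey1 => ->; rewrite adj_irr.
case/shortenP: ps ls => t pt ut ts lt.
have := @adj_acyclic _ X (v :: y1 :: t).
case: t pt ut ts lt => [|z t] pt ut ts lt; first by move: y12; rewrite -lt eqxx.
move=> /(_ isT) /negP; apply; apply/andP; split.
  have -> : cycle e [:: v, y1, z & t] = path e v (rcons [:: y1, z & t] v) by [].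
  rewrite rcons_path; apply/andP; split; first by rewrite /= ey1; exact: pt.
  by rewrite [last _ _]lt adj_sym.
rewrite cons_uniq ut andbT inE negb_or vy1 /=.
by apply: contra vs => /ts.
Qed.

Lemma farther_neighbour v : exists y, e v y /\ vnorm y = (vnorm v).+1.
Proof.
have hc := adj_degree v; have q2 := q_ge2 X.
have [y [evy dy]] : exists y, e v y /\ (vnorm v < vnorm y)%N.
  apply: contrapT => /forallNP H.
  have H' y : e v y -> (vnorm y <= vnorm v)%N.
    by move=> evy; rewrite leqNgt; apply/negP => h; apply: (H y).
  have [g [gf ginj _]] : exists g, set_bij `I_q.+1 [set y | e v y] g.
    by apply/card_set_bijP; rewrite card_eq_sym.
  have I0 : `I_q.+1 0%N by [].
  have I1 : `I_q.+1 1%N by rewrite /=; apply: leq_trans q2 _.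
  have g0 : e v (g 0%N) by apply: gf.
  have g1 : e v (g 1%N) by apply: gf.
  have := closer_neighbour_uniq g0 g1 (H' _ g0) (H' _ g1).
  by move/ginj; rewrite !inE => /(_ I0 I1).
exists y; split => //; apply/eqP; rewrite eqn_leq dy andbT.
rewrite /vnorm (leq_trans (dist_triangle o v y))// -addn1 leq_add2l.
by apply: (@dist_le v y [:: y]) => //=; rewrite evy.
Qed.

Lemma ray_ex : exists w, is_ray w.
Proof.
have [next nextP] := choice farther_neighbour.
pose w := fix w n := if n is m.+1 then next (w m) else o.
have we n : e (w n) (w n.+1) by have [] := nextP (w n).
have wn n : vnorm (w n) = n.
  elim: n => [|n IH]; first exact: distxx.
  by have [_ ->] := nextP (w n); rewrite IH.
have le_d m k : (dist (w m) (w (m + k)%N) <= k)%N.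
  elim: k => [|k IH]; first by rewrite addn0 distxx.
  apply: leq_trans (dist_triangle _ (w (m + k)%N) _) _.
  rewrite -[X in (_ <= X)%N]addn1 leq_add// addnS.
  by apply: (@dist_le _ _ [:: w (m + k).+1]) => //=; rewrite we.
exists w; split => // m n mn; apply/eqP; rewrite eqn_leq; apply/andP; split.
  by have := le_d m (n - m)%N; rewrite subnKC.
by have := dist_triangle o (w m) (w n); rewrite -!/(vnorm _) !wn leq_subLR.
Qed.

Definition boundary := {w : nat -> X | is_ray w}.

HB.instance Definition _ := gen_eqMixin boundary.
HB.instance Definition _ := gen_choiceMixin boundary.
HB.instance Definition _ := isPointed.Build boundary
  (exist _ (projT1 (cid ray_ex)) (projT2 (cid ray_ex))).

Definition ray (w : boundary) : nat -> X := sval w.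

Definition through (x : X) : set boundary := [set w | exists n, ray w n = x].

HB.instance Definition _ :=
  Measurable.copy boundary (g_sigma_algebraType (range through)).

Definition height (R : realType) (w : boundary) (x : X) : R :=
  limn (fun m => m%:R - (dist x (ray w m))%:R : R).

Definition is_boundary_measure (R : realType)
    (nu : probability boundary R) : Prop :=
  forall x, x != o ->
    nu (through x) = (q%:R / ((q%:R + 1) * q%:R ^+ vnorm x))%:E.

End tree.

(** * Complex-valued functions *)

Section complex_functions.
Context d (T : measurableType d) (R : realType).
Implicit Types (D : set T) (f : T -> R[i]).

Definition cmeasurable_fun D f : Prop :=
  measurable_fun D (fun x => complex.Re (f x)) /\ measurable_fun D (fun x => complex.Im (f x)).

Definition cintegrable (mu : {measure set T -> \bar R}) D f : Prop :=
  cmeasurable_fun D f /\ (\int[mu]_(x in D) (Normc.normc (f x))%:E < +oo)%E.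

Definition cintegral (mu : {measure set T -> \bar R}) D f : R[i] :=
  Complex (Rintegral mu D (fun x => complex.Re (f x)))
          (Rintegral mu D (fun x => complex.Im (f x))).

Definition cLnorm (mu : {measure set T -> \bar R}) (p : R) f : \bar R :=
  Lnorm mu p%:E (fun x => (Normc.normc (f x))%:E).

Definition cLp (mu : {measure set T -> \bar R}) (p : R) : set (T -> R[i]) :=
  [set f | cmeasurable_fun setT f /\ (cLnorm mu p f < +oo)%E].

End complex_functions.

Section cpow.
Context (R : realType).

(* b^z = b^(Re z) e^(i (Im z) log b), for a real base b > 0 *)
Definition cpow (b : R) (z : R[i]) : R[i] :=
  (b `^ complex.Re z)%:C%C * Complex (cos (complex.Im z * ln b)) (sin (complex.Im z * ln b)).

End cpow.

(** * Plancherel measure *)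

Section plancherel.
Context (R : realType) (q : nat).
Local Notation Q := (q%:R : R).
Local Notation I := (Complex 0 1 : R[i]).

Definition tau : R := pi / ln Q.

Definition c_P : R := Q * ln Q / (2 * pi * (Q + 1)).

Definition cfun (z : R[i]) : R[i] :=
  (Q `^ 2^-1 / (Q + 1))%:C%C *
  ((cpow Q (2^-1%:C%C + I * z) - cpow Q (- 2^-1%:C%C - I * z)) /
   (cpow Q (I * z) - cpow Q (- (I * z)))).

(* At s = 0 and s = tau, where cfun has a pole, division by zero makes the
   density 0, which is also its limit there. *)
Definition plancherel_density (s : R) : R :=
  c_P * (Normc.normc (cfun s%:C%C)) ^- 2.

Lemma c_P_ge0 : 0 <= c_P.
Proof.
have lnQ : 0 <= ln Q by case: q => [|n]; [rewrite ln0|rewrite ln_ge0// ler1n].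
have d0 : 0 <= 2 * pi * (Q + 1) by apply: mulr_ge0; rewrite ?mulr_ge0 ?pi_ge0.
by apply: divr_ge0 => //; exact: mulr_ge0.
Qed.

Lemma plancherel_density_ge0 s : 0 <= plancherel_density s.
Proof. by rewrite mulr_ge0 ?c_P_ge0// invr_ge0 exprn_even_ge0. Qed.

Lemma measurable_plancherel_density : measurable_fun setT plancherel_density.
Proof.
have mnormc (f : R -> R[i]) : cmeasurable_fun setT f ->
    measurable_fun setT (fun s => Normc.normc (f s)).
  move=> [mr mi].
  have -> : (fun s => Normc.normc (f s)) =
            (fun s => Num.sqrt (complex.Re (f s) ^+ 2 + complex.Im (f s) ^+ 2)).
    by apply/funext => s; case: (f s).
  apply: measurableT_comp.
    by apply: continuous_measurable_fun; exact: sqrt_continuous.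
  by apply: measurable_funD; apply: measurable_funX.
have mcpow (u : R -> R[i]) : cmeasurable_fun setT u ->
    cmeasurable_fun setT (fun s => cpow Q (u s)).
  move=> [mr mi].
  have mi' : measurable_fun setT (fun s => complex.Im (u s) * ln Q).
    exact: measurable_funM.
  have mp : measurable_fun setT (fun s => Q `^ complex.Re (u s)).
    exact: (measurableT_comp (measurable_powRr Q)).
  have mc : measurable_fun setT (fun s => cos (complex.Im (u s) * ln Q)).
    apply: measurableT_comp => //; apply: continuous_measurable_fun.
    exact: continuous_cos.
  have ms : measurable_fun setT (fun s => sin (complex.Im (u s) * ln Q)).
    apply: measurableT_comp => //; apply: continuous_measurable_fun.
    exact: continuous_sin.
  split.
    rewrite (_ : (fun s => _) = fun s =>
      Q `^ complex.Re (u s) * cos (complex.Im (u s) * ln Q)).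
      exact: measurable_funM.
    by apply/funext => s; rewrite /cpow /= mul0r subr0.
  rewrite (_ : (fun s => _) = fun s =>
    Q `^ complex.Re (u s) * sin (complex.Im (u s) * ln Q)).
    exact: measurable_funM.
  by apply/funext => s; rewrite /cpow /= mul0r addr0.
have mB (f g : R -> R[i]) : cmeasurable_fun setT f -> cmeasurable_fun setT g ->
    cmeasurable_fun setT (fun s => f s - g s).
  move=> [fr fi] [gr gi]; split.
    rewrite (_ : (fun s => _) = fun s => complex.Re (f s) - complex.Re (g s)).
      exact: measurable_funB.
    by apply/funext => s; case: (f s) => ? ?; case: (g s).
  rewrite (_ : (fun s => _) = fun s => complex.Im (f s) - complex.Im (g s)).
    exact: measurable_funB.
  by apply/funext => s; case: (f s) => ? ?; case: (g s).
have mC (z : R[i]) : cmeasurable_fun setT (fun _ : R => z) by split.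
have mI : cmeasurable_fun setT (fun s : R => I * s%:C%C).
  split.
    rewrite (_ : (fun s => _) = cst 0) //.
    by apply/funext => s /=; rewrite mul0r mulr0 subr0.
  rewrite (_ : (fun s => _) = id) //.
  by apply/funext => s /=; rewrite mul0r mul1r add0r.
have mN (f : R -> R[i]) : cmeasurable_fun setT f ->
    cmeasurable_fun setT (fun s => - f s).
  move=> mf; rewrite (_ : (fun s => _) = fun s => 0 - f s); first exact: mB.
  by apply/funext => s; rewrite sub0r.
have -> : plancherel_density = fun s => c_P *
   ((Normc.normc (Q `^ 2^-1 / (Q + 1))%:C%C *
    (Normc.normc (cpow Q (2^-1%:C%C + I * s%:C%C) -
                  cpow Q (- 2^-1%:C%C - I * s%:C%C)) *
    (Normc.normc (cpow Q (I * s%:C%C) - cpow Q (- (I * s%:C%C))))^-1)) ^+ 2)^-1.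
  by apply/funext => s; rewrite /plancherel_density /cfun !Normc.normcM Normc.normcV.
have minv (f : R -> R) : measurable_fun setT f -> (forall s, 0 <= f s) ->
    measurable_fun setT (fun s => (f s)^-1).
  move=> mf f0; rewrite (_ : (fun s => _) = fun s => f s `^ (-1)).
    exact: (measurableT_comp (measurable_powR (-1))).
  by apply/funext => s; rewrite powR_inv1.
have normc_ge0 (z : R[i]) : 0 <= Normc.normc z by case: z => a b; exact: sqrtr_ge0.
apply: measurable_funM => //; apply: (minv) => [|s]; last exact: exprn_even_ge0.
apply: measurable_funX.
apply: measurable_funM => //; apply: measurable_funM; last first.
  apply: minv => [|s]; last exact: normc_ge0.
  by apply: mnormc; apply: mB; apply: mcpow => //; exact: mN.
apply: mnormc; apply: (mB); apply: (mcpow); last exact: mB.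
rewrite (_ : (fun s => _) = fun s => 2^-1%:C%C - - (I * s%:C%C)).
  by apply: mB => //; exact: mN.
by apply/funext => s; rewrite opprK.
Qed.

Definition plancherel (A : set R) : \bar R :=
  (\int[lebesgue_measure]_(s in A `&` `[0%R, tau]) (plancherel_density s)%:E)%E.

Let plancherel0 : plancherel set0 = 0%E.
Proof. by rewrite /plancherel set0I integral_set0. Qed.

Let plancherel_ge0 A : (0 <= plancherel A)%E.
Proof. by apply: integral_ge0 => s _; rewrite lee_fin plancherel_density_ge0. Qed.

Let mdensity D : measurable_fun D (fun s => (plancherel_density s)%:E).
Proof.
apply: (@measurable_funS _ _ _ _ setT) => //.
by apply/measurable_EFinP; exact: measurable_plancherel_density.
Qed.

Let plancherel_sigma_additive : semi_sigma_additive plancherel.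
Proof.
move=> F mF tF mUF; rewrite /plancherel setI_bigcupl.
rewrite ge0_integral_bigcup; last 4 first.
- by move=> n; apply: measurableI; [exact: mF|exact: measurable_itv].
- exact: mdensity.
- by move=> s _; rewrite lee_fin plancherel_density_ge0.
- exact: trivIset_setIr.
by apply: is_cvg_ereal_nneg_natsum_cond => n _ _; exact: plancherel_ge0.
Qed.

HB.instance Definition _ := isMeasure.Build _ _ _ plancherel
  plancherel0 plancherel_ge0 plancherel_sigma_additive.

Let plancherel_sigma_finite : sigma_finite setT plancherel.
Proof.
exists (fun n : nat => [set s | plancherel_density s <= n%:R]).
  apply/esym; rewrite -subTset => s _.
  exists (Num.truncn (plancherel_density s)).+1 => //=.
  by rewrite ltW// truncnS_gt.
move=> n; have mFn : measurable [set s | plancherel_density s <= n%:R].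
  rewrite (_ : [set _ | _] = setT `&` plancherel_density @^-1` `]-oo, n%:R]).
    exact: measurable_plancherel_density.
  by rewrite setTI; apply/seteqP; split => s; rewrite /= in_itv.
pose L : set R := [set s | (plancherel_density s <= n%:R)%R].
pose E : set R := L `&` `[0%R, tau].
have mE : measurable E by apply: measurableI; [exact: mFn|exact: measurable_itv].
split; first exact: mFn.
have le1 : (plancherel L <= \int[lebesgue_measure]_(s in E) n%:R%:E)%E.
  rewrite /plancherel -/E; apply: ge0_le_integral; rewrite ?lee_fin//.
  - by move=> s _; rewrite lee_fin plancherel_density_ge0.
  - exact: mdensity.
  - by move=> s []; rewrite /= lee_fin.
apply: le_lt_trans le1 _; rewrite integral_cst//.
apply: lte_mul_pinfty; rewrite ?lee_fin//.
apply: (@le_lt_trans _ _ (lebesgue_measure (`[0, tau] : set R))).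
  apply: le_measure; rewrite ?inE//; last by move=> s [].
by rewrite lebesgue_measure_itv /=; case: ifP => _ //; rewrite ltry.
Qed.

HB.instance Definition _ := Measure_isSigmaFinite.Build _ _ _ plancherel
  plancherel_sigma_finite.

End plancherel.

(** * Pseudo-differential operators *)

Section pseudo_differential.
Context (R : realType) (q : nat) (X : homogeneous_tree q).
Local Notation Q := (q%:R : R).
Local Notation C := R[i].

Definition finitely_supported (f : X -> C) : Prop :=
  finite_set [set x | f x != 0].

(* The sum is junk (zero) when the summand has infinite support; it is only
   used for finitely supported f. *)
Definition fourier_helgason (f : X -> C) (w : boundary X) (s : R) : C :=
  \sum_(y \in [set: X])
    f y * cpow Q (Complex 2^-1 s * (height R w y)%:C%C).

Variables (nu : probability (boundary X) R) (sigma : X -> boundary X -> R -> C).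

(* The measure nu (x) mu; mu is carried by [0, tau]. *)
Local Notation P := (nu \x @plancherel R q)%E.
Local Notation D := ([set: boundary X] `*` `[0, tau R q]).

Definition pdo (f : X -> C) (x : X) : C :=
  cintegral P D (fun ws =>
    cpow Q (Complex 2^-1 (- ws.2) * (height R ws.1 x)%:C%C) *
    sigma x ws.1 ws.2 * fourier_helgason f ws.1 ws.2).

Definition pdo_kernel_integrand (x y : X) (ws : boundary X * R) : C :=
  cpow Q (Complex 2^-1 (- ws.2) * (height R ws.1 x)%:C%C) *
  cpow Q (Complex 2^-1 ws.2 * (height R ws.1 y)%:C%C) *
  sigma x ws.1 ws.2.

Definition pdo_kernel (xy : X * X) : C :=
  cintegral P D (pdo_kernel_integrand xy.1 xy.2).

End pseudo_differential.

(* T, given on finitely supported functions, extends to a bounded linear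
   operator on L^p. *)
Definition extends_bounded_Lp (R : realType) (q : nat) (X : homogeneous_tree q)
    (p : R) (T : (X -> R[i]) -> (X -> R[i])) : Prop :=
  let L := cLp (@counting X R) p in
  let N := cLnorm (@counting X R) p in
  exists A : (X -> R[i]) -> (X -> R[i]),
    [/\ forall f, L f -> L (A f),
        forall (a : R[i]) f g, L f -> L g ->
          A (fun x => a * f x + g x) = (fun x => a * A f x + A g x),
        exists M : R, forall f, L f -> (N (A f) <= M%:E * N f)%E
      & forall f, finitely_supported f -> A f = T f].

(* Main.v *)
(* On finitely supported f, linearity of the integral gives
   T_sigma f(x) = \sum_y f(y) K(x, y), where K is the kernel assumed to lie in
   l^p'. By Hoelder, |T_sigma f(x)| is at most ||K(x, .)||_p' ||f||_p, and the
   row norms x |-> ||K(x, .)||_p' have l^p'-norm ||K||_p' by Tonelli. Since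
   p' <= p, the l^p-norm is dominated by the l^p'-norm for counting measure,
   so ||T_sigma f||_p is bounded by a multiple of ||K||_p' ||f||_p. The tree
   matters only through the countability of its vertex set. *)
Require Import Defs.
From mathcomp Require Import all_boot all_order all_algebra.
From mathcomp Require Import complex.
From mathcomp Require Import all_classical all_reals all_analysis.
From mathcomp Require Import measurable_realfun.

Set Implicit Arguments.
Unset Strict Implicit.
Unset Printing Implicit Defensive.

Import Order.TTheory GRing.Theory Num.Theory.
Import numFieldNormedType.Exports.

Local Open Scope classical_set_scope.
Local Open Scope ring_scope.

(** * Integrals of complex-valued functions *)

Section complex_modulus.
Context {R : rcfType}.
Implicit Types z : R[i].

Lemma normc_ge0 z : 0 <= Normc.normc z.
Proof. by case: z => a b; exact: sqrtr_ge0. Qed.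

Lemma normr_Re_le_normc z : `|complex.Re z| <= Normc.normc z.
Proof.
case: z => a b; suff : `|a| <= Num.sqrt (a ^+ 2 + b ^+ 2) by [].
by rewrite -sqrtr_sqr; refine (ler_wsqrtr _); rewrite lerDl sqr_ge0.
Qed.

Lemma normr_Im_le_normc z : `|complex.Im z| <= Normc.normc z.
Proof.
case: z => a b; suff : `|b| <= Num.sqrt (a ^+ 2 + b ^+ 2) by [].
by rewrite -sqrtr_sqr; refine (ler_wsqrtr _); rewrite lerDr sqr_ge0.
Qed.

Lemma normc_le_normrD z :
  Normc.normc z <= `|complex.Re z| + `|complex.Im z|.
Proof.
case: z => a b; suff : Num.sqrt (a ^+ 2 + b ^+ 2) <= `|a| + `|b| by [].
(* With both sides written as square roots, the radicands differ by the cross term [2 |a| |b|],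
   which is nonnegative. *)
rewrite -[leRHS]ger0_norm ?addr_ge0// -(sqrtr_sqr (_ + _)); refine (ler_wsqrtr _).
rewrite sqrrD !real_normK ?num_real// addrAC lerDl.
by rewrite mulrn_wge0// mulr_ge0.
Qed.

End complex_modulus.

Section complex_integral.
Context d (T : measurableType d) (R : realType).
Variable mu : {measure set T -> \bar R}.
Variables (D : set T) (mD : measurable D).
Implicit Types (f g : T -> R[i]) (a : R[i]).

Lemma measurable_normc f : cmeasurable_fun D f ->
  measurable_fun D (fun x => Normc.normc (f x)).
Proof.
move=> [mr mi].
rewrite (_ : (fun x => _) =
  (fun x => Num.sqrt (complex.Re (f x) ^+ 2 + complex.Im (f x) ^+ 2))).
  apply: measurableT_comp.
    by apply: continuous_measurable_fun; exact: sqrt_continuous.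
  by apply: measurable_funD; exact: measurable_funX.
by apply/funext => x; case: (f x).
Qed.

(** Domination both ways: [|Re z|] and [|Im z|] are at most [|z|], and [|z|] is at most
    [|Re z| + |Im z|]. This gives access to the theory of real integrable functions. *)
Lemma cintegrableP f : cintegrable mu D f <->
  mu.-integrable D (EFin \o (fun x => complex.Re (f x))) /\
  mu.-integrable D (EFin \o (fun x => complex.Im (f x))).
Proof.
split=> [[mf foo]|[ir ii]].
  have ni : mu.-integrable D (EFin \o (fun x => Normc.normc (f x))).
    apply/integrableP; split.
      by apply/measurable_EFinP; exact: measurable_normc.
    by under eq_integral do rewrite /= ger0_norm ?normc_ge0//.
  case: mf => mr mi; split; apply: le_integrable ni => //.
  - exact/measurable_EFinP.
  - by move=> x _; rewrite lee_fin /= (ger0_norm (normc_ge0 _)) normr_Re_le_normc.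
  - exact/measurable_EFinP.
  - by move=> x _; rewrite lee_fin /= (ger0_norm (normc_ge0 _)) normr_Im_le_normc.
have mf : cmeasurable_fun D f.
  by split; apply/measurable_EFinP; [case/integrableP: ir|case/integrableP: ii].
split=> //.
have /integrableP[_] :=
  integrableD mD (integrable_abse ir) (integrable_abse ii).
apply: le_lt_trans; apply: ge0_le_integral => //.
- by move=> x _; rewrite lee_fin normc_ge0.
- by apply/measurable_EFinP; exact: measurable_normc.
- by case: mf => mr mi; apply: measurableT_comp => //; apply: emeasurable_funD;
    apply: measurableT_comp => //; exact/measurable_EFinP.
by move=> x _; rewrite lee_fin (le_trans (normc_le_normrD _))// ler_norm.
Qed.

(** The nesting [k * u + (k' * u' + v)] with real [k], [k'] lets the real statement for [k * u + v]
    be applied twice; likewise for the imaginary part. *)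
Lemma complex_Re_mulD a (z w : R[i]) : complex.Re (a * z + w) =
  complex.Re a * complex.Re z + (- complex.Im a * complex.Im z + complex.Re w).
Proof. by case: a z w => ? ? [? ?] [? ?] /=; rewrite mulNr addrA. Qed.

Lemma complex_Im_mulD a (z w : R[i]) : complex.Im (a * z + w) =
  complex.Re a * complex.Im z + (complex.Im a * complex.Re z + complex.Im w).
Proof.
by case: a z w => ? ? [? ?] [? ?] /=; rewrite addrA.
Qed.

Let integrableZD (k : R) (u v : T -> R) :
  mu.-integrable D (EFin \o u) -> mu.-integrable D (EFin \o v) ->
  mu.-integrable D (EFin \o (fun x => k * u x + v x)).
Proof. by move=> iu iv; exact: (integrableD mD (integrableZl mD k iu) iv). Qed.

Lemma cintegrable_linear a f g : cintegrable mu D f -> cintegrable mu D g ->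
  cintegrable mu D (fun x => a * f x + g x).
Proof.
move=> /cintegrableP[fr fi] /cintegrableP[gr gi]; apply/cintegrableP.
under [X in EFin \o X]eq_fun do rewrite complex_Re_mulD.
under [X in _ /\ _.-integrable _ (EFin \o X)]eq_fun do rewrite complex_Im_mulD.
by split; do 2 ?apply: integrableZD.
Qed.

Lemma cintegral_linear a f g : cintegrable mu D f -> cintegrable mu D g ->
  cintegral mu D (fun x => a * f x + g x) =
  a * cintegral mu D f + cintegral mu D g.
Proof.
move=> /cintegrableP[fr fi] /cintegrableP[gr gi].
have RZD (k : R) (u v : T -> R) :
    mu.-integrable D (EFin \o u) -> mu.-integrable D (EFin \o v) ->
    Rintegral mu D (fun x => k * u x + v x) =
    k * Rintegral mu D u + Rintegral mu D v.
  by move=> iu iv; rewrite RintegralD ?RintegralZl//; exact: (integrableZl mD k iu).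
apply/eqP; rewrite eq_complex complex_Re_mulD complex_Im_mulD /=.
under eq_Rintegral do rewrite complex_Re_mulD.
under [X in _ && (X == _)]eq_Rintegral do rewrite complex_Im_mulD.
by rewrite !RZD ?eqxx//; exact: integrableZD.
Qed.

Lemma cintegrable0 : cintegrable mu D (fun=> 0).
Proof. by apply/cintegrableP; split; exact: integrable0. Qed.

Lemma cintegral0 : cintegral mu D (fun=> 0) = 0.
Proof. by rewrite /cintegral /Rintegral/= integral0. Qed.

Lemma cintegral_sum (I : Type) (r : seq I) (c : I -> R[i])
    (f : I -> T -> R[i]) : (forall i, cintegrable mu D (f i)) ->
  cintegral mu D (fun x => \sum_(i <- r) c i * f i x) =
  \sum_(i <- r) c i * cintegral mu D (f i).
Proof.
move=> fi.
(* Integrability of the partial sums is carried through the induction, since linearity of the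
   integral requires it. *)
suff [] : cintegrable mu D (fun x => \sum_(i <- r) c i * f i x) /\
    cintegral mu D (fun x => \sum_(i <- r) c i * f i x) =
    \sum_(i <- r) c i * cintegral mu D (f i) by [].
elim: r => [|i r [IH1 IH2]].
  under eq_fun do rewrite big_nil.
  by rewrite big_nil; split; [exact: cintegrable0|exact: cintegral0].
under eq_fun do rewrite big_cons.
rewrite big_cons -IH2; split; first exact: cintegrable_linear.
exact: cintegral_linear.
Qed.

(* The modulus of an integral is bounded through its two real components, so
   with a constant 2 where 1 would do. *)
Lemma le_normc_cintegral f : cintegrable mu D f ->
  ((Normc.normc (cintegral mu D f))%:E <=
   2%:E * \int[mu]_(x in D) (Normc.normc (f x))%:E)%E.
Proof.
move=> fi; have [mf _] := fi; have /cintegrableP[fr fi'] := fi.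
have comp (h : R[i] -> R) : measurable_fun D (h \o f) ->
    mu.-integrable D (EFin \o (fun x => h (f x))) ->
    (forall z, `|h z| <= Normc.normc z) ->
    (`|Rintegral mu D (fun x => h (f x))|%:E <=
     \int[mu]_(x in D) (Normc.normc (f x))%:E)%E.
  move=> mh ih hle; rewrite EFin_normr_Rintegral//.
  apply: le_trans (le_abse_integral _ mD _) _; first exact/measurable_EFinP.
  apply: ge0_le_integral => //.
  - by apply: measurableT_comp => //; exact/measurable_EFinP.
  - by apply/measurable_EFinP; exact: measurable_normc.
  - by move=> x _; rewrite lee_fin.
case: mf => mr mi.
apply: (@le_trans _ _ (`|complex.Re (cintegral mu D f)|%:E +
                       `|complex.Im (cintegral mu D f)|%:E)%E).
  by rewrite -EFinD lee_fin normc_le_normrD.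
rewrite mule_natl mule2n; apply: leeD.
  by apply: comp => //; exact: normr_Re_le_normc.
by apply: comp => //; exact: normr_Im_le_normc.
Qed.

End complex_integral.

(** * Counting measure on a countable discrete space *)

Section counting_measure.
Context d (T : measurableType d) (R : realType).
Hypotheses (cT : countable [set: T]) (mT : forall x : T, measurable [set x]).
Implicit Types f : T -> \bar R.

Lemma countable_measurableT (A : set T) : measurable A.
Proof.
apply: countable_measurable => //.
by apply: sub_countable cT; exact: subset_card_le.
Qed.

Lemma countable_measurable_fun d' (T' : measurableType d') (D : set T)
  (f : T -> T') : measurable_fun D f.
Proof. by move=> mD Y mY; exact: countable_measurableT. Qed.

Lemma countable_cmeasurable_fun (D : set T) (f : T -> R[i]) :
  cmeasurable_fun D f.
Proof. by split; exact: countable_measurable_fun. Qed.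

Lemma counting_set1 (x : T) : @counting T R [set x] = 1%E.
Proof.
by rewrite /counting asboolT// fset_set1 finmap.cardfs1.
Qed.

Lemma integral_counting_set1 f (x : T) :
  (\int[@counting T R]_(y in [set x]) f y = f x)%E.
Proof.
rewrite (eq_integral (cst (f x))); last by move=> y; rewrite inE => ->.
by rewrite integral_cst// [X in (_ * X)%E](counting_set1 x) mule1.
Qed.

(** An injection [g] into the naturals cuts the space into fibres [F n] with at most one point each.
    Countable additivity of the integral then gives a series over the fibres, regrouped as an
    unordered sum. *)
Lemma integral_counting_esum f : (forall x, 0 <= f x)%E ->
  (\int[@counting T R]_x f x = \esum_(x in [set: T]) f x)%E.
Proof.
move=> f0; have /countable_injP[g ginj] := cT.
pose F n : set T := g @^-1` [set n].
have FT : \bigcup_n F n = setT.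
  by rewrite -subTset => x _; exists (g x).
have tF : trivIset setT F.
  apply/trivIsetP => i j _ _ /eqP ij; rewrite -subset0 => x [gi gj].
  by apply: ij; rewrite -gi -gj.
rewrite -FT ge0_integral_bigcup//; last 2 first.
- by move=> n; exact: countable_measurableT.
- exact: countable_measurable_fun.
rewrite nneseries_esumT; last by move=> n; exact: integral_ge0.
rewrite esum_bigcupT//; apply: eq_esum => n _.
have [->|/set0P[x Fnx]] := eqVneq (F n) set0.
  by rewrite integral_set0 esum_set0.
have -> : F n = [set x].
  apply/seteqP; split=> [y Fny|y ->//].
  by apply: ginj; rewrite ?inE//= Fnx Fny.
by rewrite integral_counting_set1 esum_set1.
Qed.

End counting_measure.

(** * Comparing norms through their powers *)

Lemma powR_cLnorm d (T : measurableType d) (R : realType)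
    (m : {measure set T -> \bar R}) (r : R) (f : T -> R[i]) : 0 < r ->
  (cLnorm m r f `^ r = \int[m]_x (Normc.normc (f x) `^ r)%:E)%E.
Proof.
move=> r0; rewrite /cLnorm powR_Lnorm ?gt_eqF//; apply: eq_integral => x _.
by rewrite /= ger0_norm ?normc_ge0.
Qed.

Lemma poweR_le_EFin (R : realType) (r : R) (x : \bar R) (b : R) : 0 < r ->
  (0 <= x)%E -> 0 <= b -> (x `^ r <= (b `^ r)%:E)%E -> (x <= b%:E)%E.
Proof.
move=> r0 x0 b0 xb.
(* Finiteness of [x] comes first, so that strict monotonicity of the real power applies. *)
have fx : x \is a fin_num.
  rewrite ge0_fin_numE//; apply: (@lty_poweRy _ _ r); first by rewrite gt_eqF.
  exact: le_lt_trans xb (ltry _).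
move: x0 xb; rewrite -(fineK fx) poweR_EFin !lee_fin => x0.
by apply: contraTT; rewrite -!ltNge; exact: gt0_ltr_powR.
Qed.

(** * Operators with an l^p' kernel on a countable discrete space *)

Section kernel_operator.
Context d (T : measurableType d) (R : realType).
Hypotheses (cT : countable [set: T]) (mT : forall x : T, measurable [set x]).
Variables (p p' : R) (hp : 2 <= p) (hpp' : p^-1 + p'^-1 = 1).
Variables (K : T * T -> R[i]) (hK : cLp (@counting (T * T)%type R) p' K).
Implicit Types f g : T -> R[i].

Local Notation mu := (@counting T R).
Local Notation Lp := (cLp mu p).
Local Notation N := (cLnorm mu p).
Local Notation row x := (fun y => K (x, y)).

Let p_gt0 : 0 < p. Proof. exact: lt_le_trans hp. Qed.

Let p'E : p'^-1 = 1 - p^-1. Proof. by rewrite -hpp' addrAC subrr add0r. Qed.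

Let Vp_le : p^-1 <= 2^-1. Proof. by rewrite lef_pV2 ?posrE. Qed.

Let p'_gt0 : 0 < p'.
Proof.
by rewrite -invr_gt0 p'E subr_gt0 (le_lt_trans Vp_le)// invf_lt1// ltr1n.
Qed.

(** Since [p >= 2], [1/p <= 1/2 <= 1 - 1/p = 1/p']. *)
Let p'_le_p : p' <= p.
Proof.
rewrite -lef_pV2 ?posrE// p'E lerBrDr (le_trans (lerD Vp_le Vp_le))//.
by rewrite [leRHS]splitr !div1r.
Qed.

(** The candidate for the bounded extension: an integral over counting measure, rather than a finite
    sum, makes sense on all of [l^p]. *)
Definition kernel_operator f : T -> R[i] :=
  fun x => cintegral mu setT (fun y => f y * K (x, y)).

Let pairs_countable : countable [set: T * T].
Proof. by rewrite -setXTT; exact: countableX. Qed.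

Let mpair (xy : T * T) : measurable [set xy].
Proof.
case: xy => x y; rewrite (_ : [set _] = [set x] `*` [set y]).
  exact: measurableX.
by apply/seteqP; split=> [_ -> |[a b] [/= -> ->]].
Qed.

(** Tonelli for nonnegative unordered sums: both sides sum [|K|^p'], once row by row and once over
    all pairs. *)
Lemma esum_row :
  (\esum_(x in [set: T]) cLnorm mu p' (row x) `^ p' =
   cLnorm (@counting (T * T)%type R) p' K `^ p')%E.
Proof.
have K0 xy : (0 <= (Normc.normc (K xy) `^ p')%:E)%E by rewrite lee_fin powR_ge0.
rewrite powR_cLnorm// integral_counting_esum//.
under eq_esum do rewrite powR_cLnorm// integral_counting_esum//.
rewrite esum_esum// (_ : _ `*`` _ = setT); last by apply/seteqP.
by apply: eq_esum => -[].
Qed.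

(** The norms of the kernel and of its rows as real numbers; [BE] and [kE] show that they are
    finite, so [fine] loses nothing. *)
Let B := fine (cLnorm (@counting (T * T)%type R) p' K).
Let k x := fine (cLnorm mu p' (row x)).

Let BE : cLnorm (@counting (T * T)%type R) p' K = B%:E.
Proof. by rewrite fineK// ge0_fin_numE ?Lnorm_ge0//; case: hK. Qed.

Let B_ge0 : 0 <= B. Proof. by rewrite fine_ge0// Lnorm_ge0. Qed.

Let kE x : cLnorm mu p' (row x) = (k x)%:E /\ k x <= B.
Proof.
have leB : (cLnorm mu p' (row x) <= B%:E)%E.
  apply: (poweR_le_EFin p'_gt0) => //; first exact: Lnorm_ge0.
  rewrite -poweR_EFin -BE -esum_row; apply: esum_ge.
  (* The row norm to the power [p'] is a single term of the sum in [esum_row]. *)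
  by exists [set x]; rewrite ?fsbig_set1//; split.
have fx : cLnorm mu p' (row x) \is a fin_num.
  by rewrite ge0_fin_numE ?Lnorm_ge0// (le_lt_trans leB) ?ltry.
by rewrite -lee_fin fineK.
Qed.

(** Hölder's inequality for [f] and the row at [x]; the factor 2 is that of [le_normc_cintegral]. *)
Lemma kernel_operator_row f x : Lp f ->
  cintegrable mu setT (fun y => f y * K (x, y)) /\
  Normc.normc (kernel_operator f x) <= 2 * (k x * fine (N f)).
Proof.
move=> [_ Nf].
have NfE : N f = (fine (N f))%:E by rewrite fineK// ge0_fin_numE ?Lnorm_ge0.
have mn (h : T -> R[i]) : measurable_fun [set: T] (fun y => Normc.normc (h y)).
  exact: countable_measurable_fun.
have := hoelder mu (mn (row x)) (mn f) p'_gt0 p_gt0.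
rewrite addrC => /(_ hpp'); rewrite -/(cLnorm mu p' (row x)) -/(N f).
rewrite NfE (kE x).1 -EFinM Lnorm1 => le_int.
have intE : (\int[mu]_y (Normc.normc (f y * K (x, y)))%:E <=
    (k x * fine (N f))%:E)%E.
  apply: le_trans le_int; apply: ge0_le_integral => //.
  - by move=> y _; rewrite lee_fin normc_ge0.
  - exact: countable_measurable_fun.
  - exact: countable_measurable_fun.
  - by move=> y _; rewrite lee_fin Normc.normcM mulrC ler_norm.
have fK : cintegrable mu setT (fun y => f y * K (x, y)).
  by split; [exact: countable_cmeasurable_fun|exact: le_lt_trans intE (ltry _)].
split=> //; rewrite -lee_fin EFinM.
by apply: le_trans (le_normc_cintegral measurableT fK) _; by rewrite lee_pmul2l.
Qed.

(* Row by row, the operator maps into l^p'; since p' <= p and the row norms are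
   at most B, summing their p-th powers costs a factor B `^ (p - p'). *)
Lemma kernel_operator_bounded f : Lp f ->
  (N (kernel_operator f) <= (2 * B)%:E * N f)%E.
Proof.
move=> Lf; have [_ Nf] := Lf.
have NfE : N f = (fine (N f))%:E by rewrite fineK// ge0_fin_numE ?Lnorm_ge0.
have F0 : 0 <= fine (N f) by rewrite fine_ge0// Lnorm_ge0.
have k0 x : 0 <= k x by rewrite fine_ge0// Lnorm_ge0.
rewrite NfE -EFinM; set F := fine (N f).
apply: (poweR_le_EFin p_gt0); rewrite ?Lnorm_ge0 ?mulr_ge0//.
rewrite powR_cLnorm//.
have pB (r : R) : 0 <= r -> r <= B -> r `^ p <= B `^ (p - p') * r `^ p'.
  move=> r0 rB; have -> : r `^ p = r `^ (p - p') * r `^ p'.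
    (* The base may be 0; the law of exponents still holds because the exponents add up to [p],
       which is nonzero. *)
    by rewrite -powRD ?subrK ?(gt_eqF p_gt0).
  have pp' : 0 <= p - p' by rewrite subr_ge0.
  by rewrite ler_wpM2r ?powR_ge0// ge0_ler_powR ?nnegrE.
have c0 : 0 <= (2 * F) `^ p * B `^ (p - p') by rewrite mulr_ge0 ?powR_ge0.
(* The row bound [2 * F * k x], raised to the power [p], followed by [pB] for [k x], leaves a
   constant times [k x] to the power [p'], whose sum is known from [esum_row]. *)
apply: (@le_trans _ _ (\int[mu]_x
    (((2 * F) `^ p * B `^ (p - p'))%:E * (k x `^ p')%:E))%E).
  apply: ge0_le_integral => //.
  - by move=> x _; rewrite lee_fin powR_ge0.
  - exact: countable_measurable_fun.
  - exact: countable_measurable_fun.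
  move=> x _; rewrite -EFinM lee_fin.
  apply: (@le_trans _ _ ((2 * F * k x) `^ p)).
    rewrite ge0_ler_powR ?nnegrE ?normc_ge0 ?mulr_ge0 ?(ltW p_gt0)//.
    by rewrite -mulrA (mulrC F); have [] := kernel_operator_row x Lf.
  rewrite powRM ?mulr_ge0// -mulrA ler_wpM2l ?powR_ge0//.
  by apply: pB => //; have [] := kE x.
rewrite ge0_integralZl_EFin//; last 2 first.
- by move=> x _; rewrite lee_fin powR_ge0.
- exact: countable_measurable_fun.
rewrite integral_counting_esum//; last by move=> x; rewrite lee_fin powR_ge0.
have -> : (\esum_(x in [set: T]) (k x `^ p')%:E = (B `^ p')%:E)%E.
  rewrite -poweR_EFin -BE -esum_row; apply: eq_esum => x _.
  by rewrite (kE x).1 poweR_EFin.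
(* The powers of [B] recombine to exponent [p], so the bound is exactly the [p]-th power of
   [2 * B * F]. *)
rewrite -EFinM lee_fin -mulrA -powRD ?subrK ?(gt_eqF p_gt0)//.
by rewrite -powRM ?mulr_ge0// mulrAC.
Qed.

Lemma kernel_operator_Lp f : Lp f -> Lp (kernel_operator f).
Proof.
move=> Lf; split; first exact: countable_cmeasurable_fun.
apply: le_lt_trans (kernel_operator_bounded Lf) _.
by case: Lf => _ Nf; rewrite lte_mul_pinfty ?lee_fin ?mulr_ge0.
Qed.

Lemma kernel_operator_linear (a : R[i]) f g : Lp f -> Lp g ->
  kernel_operator (fun x => a * f x + g x) =
  (fun x => a * kernel_operator f x + kernel_operator g x).
Proof.
move=> Lf Lg; apply/funext => x; rewrite /kernel_operator -cintegral_linear//.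
- by congr cintegral; apply/funext => y; rewrite mulrDl mulrA.
- by have [] := kernel_operator_row x Lf.
- by have [] := kernel_operator_row x Lg.
Qed.

End kernel_operator.

(** * Counting integrals of finitely supported functions *)

Section finitely_supported.
Context d (T : measurableType d) (R : realType).
Hypotheses (cT : countable [set: T]) (mT : forall x : T, measurable [set x]).

(** Such an [f] is a finite combination of point masses [delta z], each of integral 1, so linearity
    of the integral suffices. *)
Lemma cintegral_counting_finite (S : seq T) (f : T -> R[i]) : uniq S ->
  (forall y, y \notin S -> f y = 0) ->
  cintegral (@counting T R) setT f = \sum_(y <- S) f y.
Proof.
move=> uS f0.
pose delta (z y : T) : R[i] := Complex (\1_[set z] y) 0.
have int_delta z : (\int[@counting T R]_y (\1_[set z] y : R)%:E = 1)%E.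
  by rewrite integral_indic// setIT; exact: counting_set1.
have delta_int z : cintegrable (@counting T R) setT (delta z).
  apply/cintegrableP => //; split; last exact: integrable0.
  apply/integrableP; split; first exact: countable_measurable_fun.
  by under eq_integral do rewrite /= normr_nat; rewrite int_delta ltry.
have delta1 z : cintegral (@counting T R) setT (delta z) = 1.
  by rewrite /cintegral /Rintegral/= int_delta integral0.
have fE : f = fun y => \sum_(z <- S) f z * delta z y.
  apply/funext => y; have [yS|yS] := boolP (y \in S).
    rewrite (bigD1_seq y)//= big1 ?addr0.
      by rewrite /delta indicE mem_set// mulr1.
    move=> z zy; rewrite /delta indicE memNset ?mulr0//=.
    by move/eqP; rewrite eq_sym (negPf zy).
  rewrite f0// big_seq big1// => z zS; rewrite /delta indicE memNset ?mulr0//=.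
  by move=> yz; rewrite yz zS in yS.
rewrite {1}fE cintegral_sum//; apply: eq_bigr => z _.
by rewrite delta1 mulr1.
Qed.

End finitely_supported.

(** * The homogeneous tree *)

Section tree.
Context (q : nat) (X : homogeneous_tree q).
Local Notation o := (Defs.root X : X).

(** By connectedness every vertex ends a walk from the root. Walks of a given length have finitely
    many endpoints, by induction on the length, because every degree is finite. *)
Lemma vertex_countable : countable [set: X].
Proof.
have finW n : finite_set [set x | walk o x n].
  elim: n => [|n IH].
    apply: sub_finite_set (finite_set1 o) => x /asboolP[s [_ <-]].
    by move=> /size0nil ->.
  (* Removing the last edge of a walk of length [n.+1] exhibits its endpoint as a neighbour of the
     endpoint of a walk of length [n]. *)
  apply: (@sub_finite_set _ _ (\bigcup_(v in [set v | walk o v n])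
      [set y | @adj q X v y])).
    move=> x /asboolP[s [ps ls ss]]; case/lastP: s ps ls ss => // s y.
    rewrite rcons_path last_rcons size_rcons => /andP[ps ey] <- [ss].
    by exists (last o s) => //; apply/asboolP; exists s.
  by apply: bigcup_finite => // v _; exists q.+1; exact: adj_degree.
have -> : [set: X] = \bigcup_n [set x | walk o x n].
  by apply/esym; rewrite -subTset => x _; have [n] := walk_ex o x; exists n.
by apply: bigcup_countable => // n _; exact: finite_set_countable.
Qed.

Lemma vertex_measurable_set1 (x : X) : measurable [set x].
Proof. by []. Qed.

End tree.

(** * Kernel representation of the pseudo-differential operator *)

Section pdo_kernel_representation.
Context (R : realType) (q : nat) (X : homogeneous_tree q).
Variables (nu : probability (boundary X) R) (sigma : X -> boundary X -> R -> R[i]).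
Hypothesis habs : forall x y : X,
  cintegrable (nu \x @plancherel R q)%E
    ([set: boundary X] `*` `[0, tau R q]) (pdo_kernel_integrand sigma x y).

(** For finite support the sum over [y] is finite, and absolute convergence of the kernel integrals
    allows it to be moved under the integral over the boundary and the spectral interval. *)
Lemma pdo_kernel_operator (f : X -> R[i]) : finitely_supported f ->
  kernel_operator (pdo_kernel nu sigma) f = pdo nu sigma f.
Proof.
move=> fs; apply/funext => x.
pose S := finmap.enum_fset (fset_set [set y | f y != 0]).
have uS : uniq S by exact: finmap.fset_uniq.
have f0 y : y \notin S -> f y = 0.
  move=> yS; apply/eqP; apply: contraNT yS => fy.
  by rewrite /S in_fset_set// inE.
rewrite /kernel_operator (cintegral_counting_finite _ _ uS); last 3 first.
- exact: vertex_countable.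
- exact: vertex_measurable_set1.
- by move=> y /f0 ->; rewrite mul0r.
rewrite -cintegral_sum//; last by apply: measurableX.
congr cintegral; apply/funext => ws.
(* The Fourier-Helgason sum over all vertices reduces to the support [S], and the integrands then
   agree term by term. *)
rewrite /fourier_helgason (fsbigE S)//; last first.
  by move=> y _ /f0 ->; rewrite mul0r.
under [in RHS]eq_bigl do rewrite in_setT.
rewrite mulr_sumr; apply: eq_bigr => y _.
by rewrite [RHS]mulrCA; congr (_ * _); exact: mulrAC.
Qed.

End pdo_kernel_representation.

Theorem corollary4p1 (R : realType) (q : nat) (X : homogeneous_tree q)
  (nu : probability (boundary X) R) (hnu : is_boundary_measure nu)
  (p p' : R) (hp : 2 < p) (hp' : p^-1 + p'^-1 = 1)
  (sigma : X -> boundary X -> R -> R[i])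
  (hsigma : cmeasurable_fun ([set: X * boundary X] `*` `[0, tau R q])
     (fun u : X * boundary X * R => sigma u.1.1 u.1.2 u.2))
  (habs : forall x y : X,
     cintegrable (nu \x @plancherel R q)%E
       ([set: boundary X] `*` `[0, tau R q]) (pdo_kernel_integrand sigma x y))
  (hker : cLp (@counting (X * X)%type R) p' (pdo_kernel nu sigma)) :
  extends_bounded_Lp p (pdo nu sigma).
Proof.
have hp2 := ltW hp; have cX := @vertex_countable q X.
have mX := @vertex_measurable_set1 q X.
exists (kernel_operator (pdo_kernel nu sigma)); split.
- by move=> f; exact: (kernel_operator_Lp cX mX hp2 hp' hker).
- by move=> a f g; exact: (kernel_operator_linear cX mX hp2 hp' hker).
(* The constant left open here is twice the [l^p'] norm of the kernel. *)
- by eexists => f; exact: (kernel_operator_bounded cX mX hp2 hp' hker).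
- by move=> f; exact: pdo_kernel_operator.
Qed.
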